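(* Let $q$ be an odd prime power such that, for all sufficiently large powers $n$ of $2$, the polynomial $x^n+1$ factors over $\mathbb{F}_q$ as a product of exactly two irreducible polynomials which are reciprocals of each other (up to a nonzero scalar). Then, for any fixed integer $t\ge 2$, there are infinite families of LCD index $t$ negacirculant codes over $\mathbb{F}_q$, of lengths $tn$ with $n$ ranging over powers of $2$, of relative distance $\delta$ satisfying $$H_q(\delta)\ge\frac{t-1}{2t}.$$
   Context: The negashift maps $(x_0,\dots,x_{n-1})\in\mathbb{F}_q^n$ to $(-x_{n-1},x_0,\dots,x_{n-2})$. An $n\times n$ matrix over $\mathbb{F}_q$ is negacirculant if its rows are obtained by successive negashifts from its first row. An index $t$ negacirculant code of length $tn$ is a $[tn,n]$ linear code over $\mathbb{F}_q$ with generator matrix $(I,A_1,\dots,A_{t-1})$, with $I$ the identity matrix of order $n$ and each $A_i$ a negacirculant matrix of order $n$; equivalently, identifying $\mathbb{F}_q^n$ with $R=\mathbb{F}_q[x]/\langle x^n+1\rangle$ via coefficients, it is the $R$-submodule of $R^t$ generated by $(1,a_1,\dots,a_{t-1})$ for some $a_1,\dots,a_{t-1}\in R$. A linear code $\mathcal{C}\subset\mathbb{F}_q^N$ is LCD (linear complementary-dual) if $\mathcal{C}\cap\mathcal{C}^\perp=\{0\}$, with $\mathcal{C}^\perp$ the Euclidean dual. For a family of codes $\mathcal{C}(m)$ with parameters $[m,k_m,d_m]$ (length $m$, dimension $k_m$, minimum Hamming distance $d_m$), with $m$ ranging over infinitely many lengths, the relative distance is $\delta=\liminf_{m\to\infty}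 d_m/m$. The $q$-ary entropy function is defined for $0<y<\frac{q-1}{q}$ by $$H_q(y)=y\log_q(q-1)-y\log_q(y)-(1-y)\log_q(1-y).$$ The reciprocal of a polynomial $f$ is $x^{\deg f}f(1/x)$. *)

(* Defs.v *)
From HB Require Import structures.
From mathcomp Require Import all_boot all_order all_algebra.
From mathcomp Require Import all_classical all_reals all_analysis.

Set Implicit Arguments.
Unset Strict Implicit.
Unset Printing Implicit Defensive.

Import Order.TTheory GRing.Theory Num.Theory.
Local Open Scope ring_scope.

(* ord_pred is the cyclic predecessor, so ord_pred 0 is the last index. *)
Definition negashift (F : finFieldType) (n : nat) (x : 'rV[F]_n) : 'rV[F]_n :=
  \row_(i < n) (if (i == 0 :> nat)%N then - x 0 (ord_pred i)
                else x 0 (ord_pred i)).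

Definition negacirculant (F : finFieldType) (n : nat) (A : 'M[F]_n) : Prop :=
  exists a : 'rV[F]_n, A = \matrix_(i < n) iter i (@negashift F n) a.

(* An n x (t n) matrix is read as (B_0, ..., B_(t-1)) with square blocks:
   mxvec_index b k has value b * n + k. *)
Definition block (F : finFieldType) (t n : nat) (G : 'M[F]_(n, t * n))
    (b : 'I_t) : 'M[F]_n :=
  \matrix_(i < n, k < n) G i (mxvec_index b k).

Definition generated_by (F : finFieldType) (k N : nat) (G : 'M[F]_(k, N)) :
    {vspace 'rV[F]_N} :=
  <<[seq row i G | i : 'I_k]>>%VS.

Definition negacirculant_code (F : finFieldType) (t n : nat)
    (C : {vspace 'rV[F]_(t * n)}) : Prop :=
  exists G : 'M[F]_(n, t * n),
    [/\ forall b : 'I_t, b = 0%N :> nat -> block G b = 1%:M,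
        forall b : 'I_t, b <> 0%N :> nat -> negacirculant (block G b)
      & C = generated_by G].

Definition dual (F : finFieldType) (N : nat) (C : {vspace 'rV[F]_N}) :
    {set 'rV[F]_N} :=
  [set u : 'rV[F]_N | [forall v in C, \sum_(i < N) u 0 i * v 0 i == 0]].

Definition LCD (F : finFieldType) (N : nat) (C : {vspace 'rV[F]_N}) : Prop :=
  [set u in C] :&: dual C = [set 0].

Definition hamming_dist (F : finFieldType) (N : nat) (u v : 'rV[F]_N) : nat :=
  #|[set i : 'I_N | u 0 i != v 0 i]|.

(* N bounds every Hamming distance, so as the neutral element it only shows
   when C = 0. *)
Definition min_dist (F : finFieldType) (N : nat) (C : {vspace 'rV[F]_N}) : nat :=
  \big[minn/N]_(p : 'rV[F]_N * 'rV[F]_N |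
                [&& p.1 \in C, p.2 \in C & p.1 != p.2])
     hamming_dist p.1 p.2.

(* The sequence lies in [0, 1], so the real-valued limn_inf is the genuine
   limit inferior. *)
Definition relative_distance (R : realType) (F : finFieldType) (N : nat -> nat)
    (C : forall j : nat, {vspace 'rV[F]_(N j)}) : R :=
  limn_inf (fun j : nat => (min_dist (C j))%:R / (N j)%:R : R).

Definition logb (R : realType) (b x : R) : R := ln x / ln b.

(* Meaningful for 0 < y < (q - 1) / q. *)
Definition entropy (R : realType) (q : nat) (y : R) : R :=
  y * logb q%:R (q%:R - 1) - y * logb q%:R y
    - (1 - y) * logb q%:R (1 - y).

(* A polynomial is its coefficient sequence, constant term first, so this is
   x^(deg f) f(1/x). *)
Definition reciprocal (F : finFieldType) (f : {poly F}) : {poly F} :=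
  Poly (rev f).

(* %= is equality up to a nonzero scalar. *)
Definition two_reciprocal_factors (F : finFieldType) (p : {poly F}) : Prop :=
  exists f g : {poly F},
    [/\ irreducible_poly f, irreducible_poly g, p = f * g,
        g %= reciprocal f & f %= reciprocal g].

(* Main.v *)
Require Import Defs.
From HB Require Import structures.
From mathcomp Require Import all_boot all_order all_algebra.
From mathcomp Require Import all_classical all_reals all_analysis.
From mathcomp Require Import lra ring.

Set Implicit Arguments.
Unset Strict Implicit.
Unset Printing Implicit Defensive.

Import Order.TTheory GRing.Theory Num.Theory.
Local Open Scope ring_scope.

(* In the algebra F[S] generated by the negashift matrix S, isomorphic to
   F[x]/(x^n + 1), transposition is x |-> 1/x, and it exchanges the two factors
   of x^n + 1 = f g, both of degree m = n/2.  Let Q = q^m.  The code generated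
   by G = (I, A_1, ..., A_(t-1)) is LCD as soon as G G^T = I + sum A_i A_i^T is
   invertible; modulo each factor the failure of invertibility is a norm
   equation, so at most 4 Q^(2(t-1)-1) of the Q^(2(t-1)) codes are not LCD.
   The first block of a nonzero codeword is nonzero modulo f or g, so the word
   lies in at most Q^(t-1) codes.  Hence an LCD code of distance at least d
   exists once 2 |ball(d)| < Q^(t-1), and Chernoff's bound on |ball(d)| gives
   the entropy estimate for codes of maximal distance.  Plotkin's bound applied
   to a shortened code keeps the relative distance away from (q - 1)/q, in the
   range where the Chernoff exponent is the entropy. *)

(** * The negashift matrix *)

Section NegashiftMatrix.
Variables (F : finFieldType) (n' : nat).
Let n := n'.+1.

(** Multiplication by x on F[x]/(x^n + 1), acting on coefficient rows from the right; a signed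
    permutation matrix. *)
Definition negashift_mx : 'M[F]_n :=
  \matrix_(i, j) ((-1) ^+ (j == 0 :> nat)%N * (i == ord_pred j)%:R).
Local Notation S := negashift_mx.
Local Notation e0 := (delta_mx 0 ord0 : 'rV[F]_n).

Lemma mul_negashift_mx (x : 'rV[F]_n) : x *m S = negashift x.
Proof.
apply/rowP => j; rewrite !mxE (bigD1 (ord_pred j)) //= big1 => [|i /negPf ne].
  by rewrite mxE eqxx mulr1 addr0; case: ifP; rewrite ?mulrN1 ?mulr1.
by rewrite mxE ne mulr0 mulr0.
Qed.

Lemma tr_negashift_mxV : S^T *m S = 1%:M.
Proof.
apply/matrixP => i j; rewrite !mxE (bigD1 (ord_pred i)) //= big1 => [|k /negPf ne].
  rewrite !mxE eqxx mulr1 addr0 (inj_eq (can_inj (@ord_predK _))).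
  by case: (i =P j) => [->|_]; rewrite !(mulr0, mulr1) // -expr2 sqrr_sign.
by rewrite !mxE ne mulr0 mul0r.
Qed.

Lemma negashift_mxV : S *m S^T = 1%:M.
Proof. exact/mulmx1C/tr_negashift_mxV. Qed.

(** The row [e0] stands for the polynomial 1 and S for x; no sign appears before the exponent
    reaches n. *)
Lemma delta_mul_negashiftX (i : 'I_n) : e0 *m S ^+ i = delta_mx 0 i.
Proof.
case: i => i; elim: i => [|i IHi] lt_in.
  by rewrite expr0 mulmx1; congr delta_mx; apply: val_inj.
rewrite exprSr mulmxA (IHi (ltnW lt_in)) mul_negashift_mx.
apply/rowP => j; rewrite !mxE /= -!val_eqE /=.
case: j => [[|j] lt_jn] /=.
  by rewrite modn_small // gtn_eqF ?oppr0.
by rewrite modnDr modn_small ?eqSS // ltnW.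
Qed.

Lemma row_negashiftX (i : 'I_n) (B : 'M[F]_n) : row i B = e0 *m S ^+ i *m B.
Proof. by rewrite delta_mul_negashiftX -rowE. Qed.

Lemma negashift_mxXn : S ^+ n = - 1.
Proof.
have e0X : e0 *m S ^+ n = - e0.
  rewrite exprSr mulmxA -[n' in S ^+ n']/(val (@ord_max n')) delta_mul_negashiftX.
  rewrite mul_negashift_mx; apply/rowP => j; rewrite !mxE -!val_eqE /=.
  case: j => [[|j] lt_jn] /=.
    by rewrite modn_small ?eqxx.
  by rewrite modnDr modn_small 1?ltnW // oppr0 ltn_eqF.
apply/row_matrixP => i; rewrite row_negashiftX -mulmxA mulmxE -exprD addnC exprD.
by rewrite -mulmxE mulmxA e0X mulNmx delta_mul_negashiftX linearN /= row1.
Qed.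

(** The element a(S) of F[S]; its first row is a, so rows of length n parametrize F[S]. *)
Definition nega_mx (a : 'rV[F]_n) : 'M[F]_n := horner_mx S (rVpoly a).
Local Notation M := nega_mx.

Lemma delta_mul_nega_mx a : e0 *m M a = a.
Proof.
rewrite /nega_mx {2}(row_sum_delta a) [rVpoly a]poly_def.
rewrite linear_sum mulmx_sumr; apply: eq_bigr => i _.
rewrite valK linearZ /= rmorphXn /= horner_mx_X.
by rewrite -scalemxAr delta_mul_negashiftX.
Qed.

Lemma nega_mxB a b : M (a - b) = M a - M b.
Proof. by rewrite /nega_mx !linearB. Qed.

Lemma mul_nega_mxC a b : a *m M b = b *m M a.
Proof.
rewrite -{1}(delta_mul_nega_mx a) -{2}(delta_mul_nega_mx b) -!mulmxA.
by congr mulmx; apply: comm_horner_mx2.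
Qed.

Lemma negacirculant_nega_mx a : negacirculant (M a).
Proof.
exists a; apply/row_matrixP => i; rewrite rowK row_negashiftX -mulmxA.
have -> : S ^+ i *m M a = M a *m S ^+ i.
  by rewrite -[S in S ^+ i]horner_mx_X -rmorphXn; apply: comm_horner_mx2.
rewrite mulmxA delta_mul_nega_mx.
elim: (val i) => [|k IHk]; first by rewrite expr0 mulmx1.
by rewrite exprSr mulmxA IHk mul_negashift_mx.
Qed.

(** X^n + 1 is the minimal polynomial of S: a remainder of degree below n can be read off from the
    first row of its value at S. *)
Lemma horner_negashift_eq0 (p : {poly F}) : (horner_mx S p == 0) = ('X^n + 1 %| p).
Proof.
have S0 : horner_mx S ('X^n + 1) = 0.
  by rewrite rmorphD rmorph1 rmorphXn /= horner_mx_X negashift_mxXn addNr.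
have sD : size ('X^n + 1 : {poly F}) = n.+1 by rewrite -[1]polyC1 size_XnaddC.
have D0 : ('X^n + 1 : {poly F}) != 0 by rewrite -size_poly_eq0 sD.
apply/idP/idP => [/eqP|/dvdpP[r ->]]; last by rewrite rmorphM /= S0 mulr0.
rewrite {1}(divp_eq p ('X^n + 1)) rmorphD rmorphM /= S0 mulr0 add0r.
have le : (size (p %% ('X^n + 1))%R <= n)%N by rewrite -ltnS -sD ltn_modp.
rewrite -(poly_rV_K le) -/(M _) => /(congr1 (mulmx e0)).
rewrite delta_mul_nega_mx mulmx0 => p0.
by rewrite /dvdp -(poly_rV_K le) p0 linear0.
Qed.

Lemma trmx_horner_negashift p : (horner_mx S p)^T = horner_mx S^T p.
Proof.
elim/poly_ind: p => [|p c IHp]; first by rewrite !rmorph0 linear0.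
rewrite !(rmorphD, rmorphM) /= !horner_mx_X !horner_mx_C linearD /= tr_scalar_mx.
by rewrite trmx_mul IHp -mulmxE; congr (_ + _); apply: comm_mx_horner.
Qed.

(** S^T is the inverse of S, which is - S^(n-1), so F[S] is closed under transposition. *)
Lemma trmx_horner_negashift_poly p : exists r, (horner_mx S p)^T = horner_mx S r.
Proof.
have T : S^T = horner_mx S (- 'X^n').
  rewrite rmorphN rmorphXn /= horner_mx_X.
  apply: (can_inj (mulKmx (_ : S \in unitmx))).
    by have [] := mulmx1_unit negashift_mxV.
  by rewrite negashift_mxV mulmxN mulmxE -exprS negashift_mxXn opprK.
exists (p \Po (- 'X^n')); rewrite trmx_horner_negashift T.
elim/poly_ind: p => [|p c IHp]; first by rewrite comp_poly0 !rmorph0.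
by rewrite comp_polyD comp_polyM comp_polyX comp_polyC !(rmorphD, rmorphM) /=
  IHp !horner_mx_X !horner_mx_C.
Qed.

(* S^T is the inverse of S, so transposition acts on F[S] as x |-> 1/x. *)
Lemma horner_reciprocal p :
  horner_mx S (reciprocal p) = S ^+ (size p).-1 *m (horner_mx S p)^T.
Proof.
have ST k : S ^+ k *m S^T ^+ k = 1.
  elim: k => [|k IHk]; first by rewrite !expr0 mulmx1.
  by rewrite exprSr exprS -mulmxA (mulmxA S) negashift_mxV mul1mx.
rewrite trmx_horner_negashift /reciprocal.
have [->|p0] := eqVneq p 0; first by rewrite polyseq0 /= !rmorph0 mulmx0.
have sp : (0 < size p)%N by rewrite size_poly_gt0.
have -> : Poly (rev p) = \poly_(i < size p) p`_((size p).-1 - i).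
  apply/polyP => i; rewrite coef_Poly coef_poly; case: ltnP => [lt|le].
    by rewrite nth_rev //; case: (size p) lt sp => //= s; rewrite subSS.
  by rewrite nth_default // size_rev.
rewrite -[p in horner_mx S^T p]coefK !poly_def !linear_sum /=.
rewrite (reindex_inj rev_ord_inj) /=; apply: eq_bigr => i _.
rewrite !linearZ /= !rmorphXn /= !horner_mx_X.
have le : (i <= (size p).-1)%N by rewrite -ltnS prednK.
have -> : (size p - i.+1 = (size p).-1 - i)%N by rewrite -subn1 -subnDA add1n.
rewrite subKn //; congr (_ *: _).
by rewrite -[in RHS](subnK le) exprD -mulmxE -mulmxA ST mulmx1.
Qed.

End NegashiftMatrix.

(** * Counting over F[x]/(x^n + 1) *)

(** Translation by 1 permutes F, so the sum of all elements is unchanged when [#|F|] is added to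
    it. *)
Lemma card_natr_eq0 (F : finFieldType) : #|F|%:R = 0 :> F.
Proof.
apply: (@addrI _ (\sum_(x : F) x)); rewrite addr0 -[in LHS]sumr_const -big_split /=.
by rewrite [RHS](reindex_inj (addIr 1)).
Qed.

Lemma odd_card_two_neq0 (F : finFieldType) : odd #|F| -> 2%:R != 0 :> F.
Proof.
move=> oF; apply/eqP => F2; have := card_natr_eq0 F.
rewrite -(odd_double_half #|F|) oF natrD -muln2 natrM F2 mulr0 addr0.
by apply/eqP; rewrite oner_eq0.
Qed.

Section Factors.
Variables (F : finFieldType) (n' m : nat).
Let n := n'.+1.
Hypothesis n2m : n = m.*2.
Hypothesis n_neq0 : n%:R != 0 :> F.
Local Notation S := (negashift_mx F n').
Local Notation M := (@nega_mx F n').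
Local Notation H := (horner_mx S).

(** The body of [two_reciprocal_factors] at X^n + 1, with the factors as parameters so that they can
    be exchanged. *)
Definition reciprocal_factors (f g : {poly F}) : Prop :=
  [/\ irreducible_poly f, irreducible_poly g, 'X^n + 1 = f * g,
      g %= reciprocal f & f %= reciprocal g].

Lemma reciprocal_factorsC f g : reciprocal_factors f g -> reciprocal_factors g f.
Proof. by case=> fI gI fg gf gf'; split=> //; rewrite mulrC. Qed.

(** Taking reciprocals never raises the degree, so the factors have equal degrees, half of n
    each. *)
Lemma size_reciprocal_factors f g : reciprocal_factors f g -> size f = m.+1.
Proof.
case=> fI gI fgD gf fg.
have sr (p : {poly F}) : (size (reciprocal p) <= size p)%N.
  by rewrite -(size_rev p) size_Poly.
have sfg : size f = size g.
  by apply/eqP; rewrite eqn_leq {1}(eqp_size fg) sr {1}(eqp_size gf) sr.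
have /(congr1 (fun p : {poly F} => size p)) := fgD.
rewrite -[1]polyC1 size_XnaddC // size_mul ?irredp_neq0 // -sfg n2m addnn.
move/eqP; rewrite -[size f]prednK ?(ltn_trans _ fI.1) // doubleS /= eqSS.
by move/eqP/double_inj => <-.
Qed.

(* X^n + 1 is separable because n is invertible in F. *)
Lemma coprimep_reciprocal_factors f g : reciprocal_factors f g -> coprimep f g.
Proof.
case=> fI gI fgD _ _; rewrite irreducible_poly_coprime //; apply/negP => fg.
have fD : f %| 'X^n + 1 by rewrite fgD dvdp_mulr.
have : f %| ('X^n + 1)^`() by rewrite fgD derivM dvdp_add ?(dvdp_mull _ fg) ?dvdp_mulr.
rewrite derivD derivXn derivC addr0 -scaler_nat dvdpZr // => fX.
move: fD; rewrite dvdp_addr; last by rewrite exprS dvdp_mull.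
by rewrite dvdp1 gtn_eqF // fI.1.
Qed.

(** Multiplication by [H f] thus expresses reduction modulo g inside F[S]. *)
Lemma reciprocal_factors_dvd f g p :
  reciprocal_factors f g -> (H f * H p == 0) = (g %| p).
Proof.
case=> fI gI fgD _ _.
by rewrite -rmorphM /= horner_negashift_eq0 -/n fgD dvdp_mul2l ?irredp_neq0.
Qed.

(* The automorphism x |-> 1/x of F[x]/(x^n + 1) exchanges the two factors. *)
Lemma reciprocal_factors_dvd_tr f g p :
  reciprocal_factors f g -> H f * (H p)^T = 0 -> f %| p.
Proof.
move=> fgP; have [_ _ _ gf _] := fgP.
move/(congr1 trmx); rewrite -mulmxE trmx_mul trmxK trmx0 => pf0.
rewrite -(reciprocal_factors_dvd p (reciprocal_factorsC fgP)) -rmorphM /=.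
rewrite horner_negashift_eq0 (eqp_dvdr _ (eqp_mulr _ gf)) -horner_negashift_eq0.
rewrite mulrC rmorphM /= horner_reciprocal.
have [r fr] := trmx_horner_negashift_poly n' f; move: pf0; rewrite fr => pf0.
rewrite mulmxE -[S in S ^+ _]horner_mx_X -rmorphXn /= -!rmorphM /= mulrCA.
by rewrite rmorphM /= rmorphM /= -!mulmxE pf0 mulmx0.
Qed.

(** Chinese remainders: f and g are coprime with product of degree n, and a has degree below n. *)
Lemma rVpoly_eq0_dvd f g (a : 'rV[F]_n) :
  reciprocal_factors f g -> f %| rVpoly a -> g %| rVpoly a -> a = 0.
Proof.
move=> fgP fa ga; have [_ _ fgD _ _] := fgP.
rewrite -[a]rVpolyK; suff -> : rVpoly a = 0 by rewrite linear0.
apply/eqP; apply: contraT => a0.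
have : (size ('X^n + 1 : {poly F})%R <= size (rVpoly a))%N.
  by rewrite dvdp_leq // fgD Gauss_dvdp ?fa ?coprimep_reciprocal_factors.
by rewrite -[1]polyC1 size_XnaddC // ltnNge size_poly.
Qed.

Lemma delta_mul_horner_eq0 p : (delta_mx 0 ord0 : 'rV[F]_n) *m H p = 0 -> H p = 0.
Proof.
move=> p0; apply/row_matrixP => i; rewrite row_negashiftX -mulmxA row0.
rewrite -[S in S ^+ _]horner_mx_X -rmorphXn /= mulmxE (comm_horner_mx2 S _ p).
by rewrite -mulmxE mulmxA p0 mul0mx.
Qed.

(** For counting: a multiple of f is determined by its quotient, which has m coefficients. *)
Lemma poly_rV_divp_inj f g (a b : 'rV[F]_n) : reciprocal_factors f g ->
  f %| rVpoly a -> f %| rVpoly b ->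
  poly_rV (rVpoly a %/ f) = poly_rV (rVpoly b %/ f) :> 'rV_m -> a = b.
Proof.
move=> fgP fa fb /(congr1 rVpoly); have [fI _ _ _ _] := fgP.
have le c : (size (rVpoly (c : 'rV[F]_n) %/ f)%R <= m)%N.
  rewrite size_divp ?irredp_neq0 // (size_reciprocal_factors fgP) leq_subLR.
  by rewrite addnn -n2m size_poly.
rewrite !poly_rV_K // => /(congr1 (fun p => p * f)); rewrite !divpK //.
exact: (can_inj rVpolyK).
Qed.

(** The rows of the difference of two solutions are killed by u modulo f; u is invertible modulo f,
    so they are multiples of f. *)
Lemma card_mul_nega_mx_dvd f g r (u : 'rV[F]_n) (W : 'M[F]_(r, n)) :
  reciprocal_factors f g -> ~~ (f %| rVpoly u) ->
  (#|[set a : 'M[F]_(r, n) | a *m M u == W]%SET| <= #|F| ^ (r * m))%N.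
Proof.
move=> fgP fu; set A := [set a | _]%SET.
have [fI gI fgD _ _] := fgP.
have [->|/set0Pn[a0]] := eqVneq A finset.set0; first by rewrite cards0.
rewrite inE => /eqP a0W.
have fA a i : a \in A -> f %| rVpoly (row i (a - a0)).
  rewrite inE => /eqP aW.
  have : H (rVpoly (row i (a - a0)) * rVpoly u) = 0.
    apply: delta_mul_horner_eq0; rewrite rmorphM /= -mulmxE mulmxA.
    by rewrite delta_mul_nega_mx -row_mul mulmxBl aW a0W subrr row0.
  move/eqP; rewrite horner_negashift_eq0 fgD => /(dvdp_trans (dvdp_mulIl _ _)).
  by rewrite Gauss_dvdpl // irreducible_poly_coprime.
pose h a : 'M[F]_(r, m) := \matrix_i poly_rV (rVpoly (row i (a - a0)) %/ f).
rewrite -card_mx; apply: (@leq_card_in _ _ h) => a b Aa Ab /row_matrixP hab.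
apply: (addIr (- a0)); apply/row_matrixP => i; have := hab i; rewrite !rowK.
exact: poly_rV_divp_inj fgP (fA _ _ Aa) (fA _ _ Ab).
Qed.

(** A nonzero u is nonzero modulo at least one factor. *)
Lemma card_mul_nega_mx f g r (u : 'rV[F]_n) (W : 'M[F]_(r, n)) :
  reciprocal_factors f g -> u != 0 ->
  (#|[set a : 'M[F]_(r, n) | a *m M u == W]%SET| <= #|F| ^ (r * m))%N.
Proof.
move=> fgP u0; have [fu|] := boolP (f %| rVpoly u); last first.
  exact: card_mul_nega_mx_dvd fgP.
apply: card_mul_nega_mx_dvd (reciprocal_factorsC fgP) _; apply/negP => gu.
by rewrite (rVpoly_eq0_dvd fgP fu gu) eqxx in u0.
Qed.

(* Modulo g the equation is a norm equation C + a * a^* = 0; when a is not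
   divisible by g, a mod g determines a^* mod g, that is, a mod f. *)
Lemma card_norm_equation f g (C : 'M[F]_n) : reciprocal_factors f g ->
  (#|[set a : 'rV[F]_n | (H f * (C + M a *m (M a)^T) == 0)%R]%SET| <= 2 * #|F| ^ m)%N.
Proof.
move=> fgP; set A := [set a | _]%SET; have gfP := reciprocal_factorsC fgP.
have [fI gI fgD _ _] := fgP.
(* Split by divisibility by g: multiples of g are counted by quotients, the others by residues
   modulo g. *)
rewrite -(cardsID [set a | g %| rVpoly a]%SET A) mul2n -addnn leq_add //.
  rewrite -[m]mul1n -card_mx.
  apply: (@leq_card_in _ _ (fun a : 'rV[F]_n => poly_rV (rVpoly a %/ g) : 'rV_m)).
  by move=> a b /setIP[_]; rewrite inE => ga /setIP[_]; rewrite inE => gb;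
    apply: poly_rV_divp_inj gfP _ _.
rewrite -[X in (_ ^ X)%N]mul1n -card_mx.
apply: (@leq_card_in _ _ (fun a : 'rV[F]_n => poly_rV (rVpoly a %% g) : 'rV_m)).
move=> a b; rewrite !inE => /andP[ga /eqP Aa] /andP[_ /eqP Ab].
have sm (c : 'rV[F]_n) : (size (rVpoly c %% g)%R <= m)%N.
  by rewrite -ltnS -(size_reciprocal_factors gfP) ltn_modp irredp_neq0.
move/(congr1 rVpoly); rewrite !poly_rV_K // => mab.
have gab : g %| rVpoly (a - b) by rewrite linearB /dvdp modpD modpN mab subrr.
(* It suffices that f divides a - b, that is, that the transpose of [M (a - b)] vanishes modulo
   g. *)
apply/eqP; rewrite -subr_eq0; apply/eqP; apply: (rVpoly_eq0_dvd fgP) => //.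
apply: (reciprocal_factors_dvd_tr fgP).
have Mab : H f * M a = H f * M b.
  apply/eqP; rewrite -subr_eq0 -mulrBr -nega_mxB.
  by rewrite /nega_mx (reciprocal_factors_dvd _ fgP).
have [r rE] := trmx_horner_negashift_poly n' (rVpoly (a - b)); rewrite rE.
apply/eqP; rewrite (reciprocal_factors_dvd _ fgP).
(* Multiply by a, which is prime to g; since a = b modulo g, the two norm equations can then be
   compared. *)
rewrite -(@Gauss_dvdpr _ r (rVpoly a)) ?irreducible_poly_coprime //.
rewrite -(reciprocal_factors_dvd _ fgP) rmorphM /= -rE -/(M _) -/(M _) nega_mxB.
rewrite linearB /= mulrBr mulrBr subr_eq0; apply/eqP; apply: (@addrI _ (H f * C)).
by rewrite mulmxE in Aa Ab *; rewrite -mulrDr Aa mulrA Mab -mulrA -mulrDr Ab.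
Qed.

(** The Gram matrix G G^T of the generator (I, A_1, ..., A_r), where A_i is [M] of the i-th row of
    a. *)
Definition nega_gram r (a : 'M[F]_(r, n)) : 'M[F]_n :=
  1 + \sum_(i < r) M (row i a) *m (M (row i a))^T.

Lemma nega_gram_horner r (a : 'M[F]_(r, n)) : exists p, nega_gram a = H p.
Proof.
have h i : {p | M (row i a) *m (M (row i a))^T = H p}.
  apply: cid; have [p pE] := trmx_horner_negashift_poly n' (rVpoly (row i a)).
  by exists (rVpoly (row i a) * p); rewrite rmorphM /= -pE.
exists (1 + \sum_i sval (h i)); rewrite rmorphD rmorph1 rmorph_sum; congr (_ + _).
by apply: eq_bigr => i _; case: (h i).
Qed.

(** An element prime to both factors is invertible modulo X^n + 1 by Bezout. *)
Lemma nega_gram_unit f g r (a : 'M[F]_(r, n)) : reciprocal_factors f g ->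
  nega_gram a \notin unitmx -> (H f * nega_gram a == 0) || (H g * nega_gram a == 0).
Proof.
move=> fgP; have gfP := reciprocal_factorsC fgP; have [fI gI fgD _ _] := fgP.
have [p ->] := nega_gram_horner a; apply: contraR.
rewrite (reciprocal_factors_dvd _ fgP) (reciprocal_factors_dvd _ gfP) negb_or.
rewrite -!irreducible_poly_coprime // => /andP[gp fp].
have : coprimep p (f * g) by rewrite coprimepMr coprimep_sym fp coprimep_sym.
rewrite -fgD => /Bezout_eq1_coprimepP[[u v] /= /(congr1 H)].
rewrite rmorphD !rmorphM rmorph1 /= (eqP (_ : H ('X^n + 1) == 0)); last first.
  by rewrite horner_negashift_eq0.
by rewrite mulr0 addr0 => /mulmx1_unit[].
Qed.

Lemma nega_gram_row' r (a : 'M[F]_(r.+1, n)) :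
  nega_gram a = nega_gram (row' ord0 a) + M (row ord0 a) *m (M (row ord0 a))^T.
Proof.
rewrite /nega_gram big_ord_recl addrCA addrC; congr (_ + _ + _).
apply: eq_bigr => i _.
by congr (M _ *m (M _)^T); apply/rowP => j; rewrite !mxE.
Qed.

Lemma row0_row'_inj r (a b : 'M[F]_(r.+1, n)) :
  row ord0 a = row ord0 b -> row' ord0 a = row' ord0 b -> a = b.
Proof.
move=> ab0 ab; apply/row_matrixP => i; case: (unliftP ord0 i) => [j|] -> //.
have /rowP E : row j (row' ord0 a) = row j (row' ord0 b) by rewrite ab.
by apply/rowP => k; have := E k; rewrite !mxE.
Qed.

(** Once the other rows are fixed, the first row solves a norm equation. *)
Lemma card_nega_gram_factor f g r : reciprocal_factors f g ->
  (#|[set a : 'M[F]_(r.+1, n) | (H f * nega_gram a == 0)%R]%SET|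
     <= #|F| ^ (r * n) * (2 * #|F| ^ m))%N.
Proof.
move=> fgP; set A := [set a | _]%SET.
rewrite -sum1_card (partition_big (row' ord0) predT) //=.
rewrite -card_mx -sum_nat_const leq_sum // => c _; rewrite sum1dep_card.
apply: leq_trans (card_norm_equation (nega_gram c) fgP).
rewrite -(card_in_imset (f := row ord0)) => [|a b]; last first.
  rewrite inE => /andP[_ /eqP ac]; rewrite inE => /andP[_ /eqP bc] ab0.
  by apply: row0_row'_inj; rewrite ?ac.
apply/subset_leq_card/fintype.subsetP => _ /imsetP[a + ->].
rewrite inE => /andP[aA /eqP ac]; rewrite inE -ac -nega_gram_row'.
by move: aA; rewrite inE.
Qed.

Lemma card_nega_gram_nonunit f g r : reciprocal_factors f g ->
  (#|[set a : 'M[F]_(r.+1, n) | nega_gram a \notin unitmx]%SET|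
     <= #|F| ^ (r * n) * (4 * #|F| ^ m))%N.
Proof.
move=> fgP; have gfP := reciprocal_factorsC fgP.
rewrite -[4%N]/(2 + 2)%N mulnDl mulnDr.
apply: leq_trans (leq_add (card_nega_gram_factor r fgP) (card_nega_gram_factor r gfP)).
apply: leq_trans (leq_card_setU _ _); apply/subset_leq_card/fintype.subsetP => a.
by rewrite !inE; apply: nega_gram_unit.
Qed.

End Factors.

(** * Negacirculant codes *)

Lemma card_bigcup_leq (I T : finType) (P : pred I) (E : I -> {set T}) :
  (#|\bigcup_(i | P i) E i| <= \sum_(i | P i) #|E i|)%N.
Proof.
elim/big_rec2: _ => [|i x y _ xy]; first by rewrite cards0.
by apply: leq_trans (leq_card_setU _ _) _; rewrite leq_add2l.
Qed.

Section Codes.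
Variable F : finFieldType.

Definition weight N (w : 'rV[F]_N) : nat := #|[set i | w 0 i != 0]%SET|.

(** The inequality is strict, so that words outside the ball have weight at least d. *)
Definition ball N d : {set 'rV[F]_N} := [set w | (weight w < d)%N]%SET.

Lemma hamming_distE N (u v : 'rV[F]_N) : hamming_dist u v = weight (u - v).
Proof. by apply: eq_card => i; rewrite !inE !mxE subr_eq0. Qed.

Lemma generated_byP k N (G : 'M[F]_(k, N)) w :
  reflect (exists u, w = u *m G) (w \in generated_by G).
Proof.
apply: (iffP idP) => [|[u ->]]; last first.
  rewrite mulmx_sum_row memv_suml // => i _.
  by rewrite memvZ // memv_span //; apply/fintype.imageP; exists i.
pose U := limg (linfun (mulmxr G : 'rV[F]_k -> 'rV[F]_N)).
suff /subvP sub : (generated_by G <= U)%VS.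
  by move/sub => /memv_imgP[u _]; rewrite lfunE /=; exists u.
apply/span_subvP => _ /fintype.imageP[i _ ->]; apply/memv_imgP.
by exists (delta_mx 0 i); rewrite ?memvf // lfunE /= -rowE.
Qed.

Lemma leq_min_dist N (C : {vspace 'rV[F]_N}) d : (d <= N)%N ->
  (forall w, w \in C -> w != 0 -> (d <= weight w)%N) -> (d <= min_dist C)%N.
Proof.
move=> dN dC; rewrite /min_dist; elim/big_ind: _ => // [x y dx dy|[u v]].
  by rewrite leq_min dx.
move=> /and3P[/= uC vC uv]; rewrite hamming_distE dC ?memvB //.
by rewrite subr_eq0.
Qed.

Lemma min_dist_leq N (C : {vspace 'rV[F]_N}) w : w \in C -> w != 0 ->
  (min_dist C <= weight w)%N.
Proof.
move=> wC w0; rewrite -[w in weight w]subr0 -hamming_distE /min_dist -minEnat.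
apply: (@bigmin_le_cond _ _ _ N (w, 0 : 'rV_N) _ (fun p => hamming_dist p.1 p.2)).
by rewrite /= wC mem0v w0.
Qed.

Lemma min_dist_le_length N (C : {vspace 'rV[F]_N}) : (min_dist C <= N)%N.
Proof.
rewrite /min_dist; elim/big_rec: _ => // p x _ xN.
by rewrite geq_min xN orbT.
Qed.

(** A codeword u G orthogonal to all rows of G satisfies u G G^T = 0. *)
Lemma LCD_generated_by k N (G : 'M[F]_(k, N)) :
  G *m G^T \in unitmx -> LCD (generated_by G).
Proof.
move=> Gu; apply/setP => w; rewrite !inE; apply/andP/eqP => [[]|->]; last first.
  split; first exact: mem0v.
  by apply/forall_inP => v _; rewrite big1 // => i _; rewrite mxE mul0r.
move/generated_byP => [u ->] /forall_inP uG.
suff -> : u = 0 by rewrite mul0mx.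
rewrite -[u](mulmxK Gu); suff -> : u *m (G *m G^T) = 0 by rewrite mul0mx.
apply/rowP => j; rewrite [RHS]mxE mulmxA.
have jG : row j G \in generated_by G.
  by apply/generated_byP; exists (delta_mx 0 j); rewrite -rowE.
rewrite -(eqP (uG _ jG)) mxE; apply: eq_bigr => i _.
by rewrite [_^T _ _]mxE [row j G _ _]mxE.
Qed.

Section Generator.
Variables (n' s : nat).
Let n := n'.+1.
Local Notation M := (@nega_mx F n').

(** The index t is [s.+2]: block 0 is the identity and row j of a gives block j + 1. *)
Definition nega_block (a : 'M[F]_(s.+1, n)) (b : 'I_s.+2) : 'M[F]_n :=
  if unlift ord0 b is Some j then M (row j a) else 1%:M.

Definition nega_gen (a : 'M[F]_(s.+1, n)) : 'M[F]_(n, s.+2 * n) :=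
  \matrix_i mxvec (\matrix_b row i (nega_block a b)).

Definition nega_code (a : 'M[F]_(s.+1, n)) := generated_by (nega_gen a).

Lemma block_nega_gen a b : block (nega_gen a) b = nega_block a b.
Proof. by apply/matrixP => i k; rewrite !mxE mxvecE !mxE. Qed.

Lemma negacirculant_nega_code a : negacirculant_code (nega_code a).
Proof.
exists (nega_gen a); split => // b b0; rewrite block_nega_gen /nega_block.
  by rewrite (_ : b = ord0) ?unlift_none //; apply: val_inj.
case: (unliftP ord0 b) => [j _|b0']; first exact: negacirculant_nega_mx.
by rewrite b0' in b0.
Qed.

Lemma mul_nega_gen a (u : 'rV[F]_n) :
  u *m nega_gen a = mxvec (\matrix_b (u *m nega_block a b)).
Proof.
apply/rowP => k; case/mxvec_indexP: k => b k; rewrite mxvecE !mxE.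
by apply: eq_bigr => i _; rewrite mxE mxvecE !mxE.
Qed.

Lemma nega_gen_gram a : nega_gen a *m (nega_gen a)^T = nega_gram a.
Proof.
transitivity (\sum_b nega_block a b *m (nega_block a b)^T).
  apply/matrixP => i j; rewrite mxE summxE (reindex _ (curry_mxvec_bij _ _)) /=.
  under [RHS]eq_bigr do rewrite mxE; rewrite pair_bigA /=.
  by apply: eq_bigr => -[b k] _; rewrite /= !mxE !mxvecE !mxE.
rewrite big_ord_recl /nega_gram; congr (_ + _).
  by rewrite /nega_block unlift_none trmx1 mulmx1.
by apply: eq_bigr => i _; rewrite /nega_block liftK.
Qed.

(** By commutativity the block u [M a_j] of a codeword equals a_j [M u], so containing w imposes
    linear equations on a. *)
Lemma nega_codeP a w : w \in nega_code a ->
  exists u, [/\ u = row ord0 (vec_mx w), w != 0 -> u != 0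
    & a *m M u = \matrix_j row (lift ord0 j) (vec_mx w)].
Proof.
case/generated_byP => u wE; exists u.
have Wb b : row b (vec_mx w) = u *m nega_block a b.
  by rewrite wE mul_nega_gen mxvecK rowK.
split; first by rewrite Wb /nega_block unlift_none mulmx1.
  by apply: contraNneq => u0; rewrite wE u0 mul0mx.
apply/row_matrixP => j; rewrite rowK Wb /nega_block liftK row_mul.
exact: mul_nega_mxC.
Qed.

End Generator.

(** Union bound: at most half of the arrays a have a singular Gram matrix, and fewer than half give
    a code with a nonzero word of weight below d. *)
Lemma exists_LCD_nega_code n' m s (f g : {poly F}) d :
    n'.+1 = m.*2 -> n'.+1%:R != 0 :> F -> reciprocal_factors n' f g ->
    (8 <= #|F| ^ m)%N -> (d <= s.+2 * n'.+1)%N ->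
    (2 * #|ball (s.+2 * n'.+1) d| < #|F| ^ (s.+1 * m))%N ->
  exists C : {vspace 'rV[F]_(s.+2 * n'.+1)},
    [/\ negacirculant_code C, LCD C & (d <= min_dist C)%N].
Proof.
move=> n2m n0 fgP q8 dN Vd; pose n := n'.+1.
pose A1 := [set a : 'M[F]_(s.+1, n) | nega_gram a \notin unitmx]%SET.
pose cw (w : 'rV[F]_(s.+2 * n)) := [set a : 'M[F]_(s.+1, n) | w \in nega_code a]%SET.
pose A2 := \bigcup_(w in ball (s.+2 * n) d :\ 0) cw w.
have cA1 : (2 * #|A1| <= #|F| ^ (s.+1 * n))%N.
  (* One factor q^m absorbs the constant 2 * 4, by [q8]. *)
  have := card_nega_gram_nonunit n2m n0 s fgP; rewrite -(leq_pmul2l (isT : 0 < 2)%N).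
  move/leq_trans; apply.
  have -> : (s.+1 * n = s * n + (m + m))%N by rewrite mulSn addnC addnn -n2m.
  rewrite !expnD.
  by rewrite mulnCA leq_mul2l mulnA leq_mul2r q8 !orbT.
have cw_le w : w != 0 -> (#|cw w| <= #|F| ^ (s.+1 * m))%N.
  move=> w0; have [->|/set0Pn[a]] := eqVneq (cw w) finset.set0; first by rewrite cards0.
  rewrite inE => /nega_codeP[u [uE u0 _]].
  pose W := \matrix_j row (lift ord0 j) (vec_mx w).
  apply: leq_trans (card_mul_nega_mx n2m n0 W fgP (u0 w0)).
  apply/subset_leq_card/fintype.subsetP => b; rewrite !inE => /nega_codeP[v [vE _ vW]].
  by rewrite /W -vW uE vE.
have cA2 : (2 * #|A2| < #|F| ^ (s.+1 * n))%N.
  (* One factor q^((t-1)m) bounds each [cw w], the other exceeds twice the ball. *)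
  have -> : (s.+1 * n = s.+1 * m + s.+1 * m)%N by rewrite -mulnDr addnn -n2m.
  rewrite expnD.
  apply: (@leq_ltn_trans (2 * (#|ball (s.+2 * n) d| * #|F| ^ (s.+1 * m)))%N); last first.
    by rewrite mulnA ltn_pmul2r // (leq_ltn_trans _ Vd).
  rewrite leq_mul2l /=; apply: leq_trans (card_bigcup_leq _ _) _.
  apply: (@leq_trans (\sum_(w in ball (s.+2 * n) d :\ 0%R) #|F| ^ (s.+1 * m))%N).
    by apply: leq_sum => w; rewrite !inE => /andP[w0 _]; apply: cw_le.
  by rewrite sum_nat_const leq_mul2r subset_leq_card ?subD1set ?orbT.
have /fintype.properP[_ [a _]] : A1 :|: A2 \proper [set: 'M[F]_(s.+1, n)]%SET.
  rewrite properEcard finset.subsetT /= cardsT card_mx -(ltn_pmul2l (isT : 0 < 2)%N).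
  apply: (@leq_ltn_trans (2 * (#|A1| + #|A2|)))%N.
    by rewrite leq_mul2l /= leq_card_setU.
  by rewrite mulnDr [ltnRHS]mul2n -addnn -addnS leq_add.
rewrite finset.inE negb_or => /andP[aA1 aA2]; exists (nega_code a).
split; first exact: negacirculant_nega_code.
  by apply: LCD_generated_by; rewrite nega_gen_gram; move: aA1; rewrite inE negbK.
apply: leq_min_dist => // w wC w0; rewrite leqNgt; apply: contra aA2 => wd.
by apply/finset.bigcupP; exists w; rewrite !inE ?w0.
Qed.

End Codes.

(** * Ball volume and Plotkin's bound *)

(** The weight enumerator of the whole space factors over the coordinates. *)
Lemma sum_weight_expr (F : finFieldType) (R : comPzRingType) N (z : R) :
  \sum_(w : 'rV[F]_N) z ^+ weight w = (1 + (#|F|.-1)%:R * z) ^+ N.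
Proof.
have -> : 1 + (#|F|.-1)%:R * z = \sum_(x : F) (if x != 0 then z else 1).
  rewrite (bigD1 0) //= eqxx /= (eq_bigr (fun=> z)) => [|x ->] //.
  by rewrite sumr_const -(cardC1 (0 : F)) mulr_natl.
rewrite -[N in RHS]card_ord -prodr_const bigA_distr_bigA /=.
rewrite (reindex (fun f : {ffun 'I_N -> F} => \row_i f i)) /=; last first.
  exists (fun w : 'rV_N => [ffun i => w 0 i]) => [f _|w _].
    by apply/ffunP => i; rewrite ffunE mxE.
  by apply/rowP => i; rewrite mxE ffunE.
apply: eq_bigr => f _; rewrite -prodr_const big_mkcond /=.
by apply: eq_bigr => i _; rewrite inE mxE.
Qed.

(* Chernoff's method: sum z^(weight w) over all words w. *)
Lemma card_ball_le (F : finFieldType) (R : realType) N d (y z : R) :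
    0 < z <= 1 -> (forall k, (k < d)%N -> k%:R <= y * N%:R) ->
  #|ball F N d|%:R <= expR (N%:R * (ln (1 + (#|F|.-1)%:R * z) - y * ln z)).
Proof.
case/andP => z0 z1 dy.
have p0 : 0 < 1 + (#|F|.-1)%:R * z by rewrite ltr_wpDr // mulr_ge0 // ltW.
rewrite mulrBr expRB expRM_natl lnK ?posrE // -sum_weight_expr.
rewrite ler_pdivlMr ?expR_gt0 // mulr_natl -sumr_const.
(* On the ball the weight is at most y N, and powers of z <= 1 do not increase with the exponent. *)
apply: (@le_trans _ _ (\sum_(w in ball F N d) z ^+ weight w)).
  apply: ler_sum => w; rewrite inE => /dy wy.
  rewrite -[z in leRHS]lnK ?posrE // -expRM_natl ler_expR mulrA.
  by rewrite ler_wnM2r ?ln_le0 // mulrC.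
rewrite [leRHS](bigID (mem (ball F N d))) /= lerDl sumr_ge0 // => w _.
by rewrite exprn_ge0 // ltW.
Qed.

Lemma card_rV (T : finType) n : #|{: 'rV[T]_n}| = (#|T| ^ n)%N.
Proof. by rewrite card_mx mul1n. Qed.

(** Each fibre of a linear form embeds in its kernel by translation, so the kernel is at least a
    fraction 1/q of the space. *)
Lemma card_mulmx_neq0 (F : finFieldType) m (c : 'cV[F]_m) :
  (#|F| * #|[set u : 'rV[F]_m | u *m c != 0%R]%SET| <= #|F|.-1 * #|F| ^ m)%N.
Proof.
pose K := [set u : 'rV[F]_m | u *m c == 0]%SET.
have qK : (#|F| ^ m <= #|F| * #|K|)%N.
  rewrite -card_rV -[leqLHS]sum1_card.
  rewrite (partition_big (fun u : 'rV[F]_m => (u *m c) 0 0) predT) //=.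
  rewrite -sum_nat_const leq_sum // => x _; rewrite sum1dep_card.
  set X := [set u | _]%SET; have [->|/set0Pn[u0]] := eqVneq X finset.set0.
    by rewrite cards0.
  rewrite inE => /eqP u0x; rewrite -(card_imset _ (addIr (- u0))).
  apply/subset_leq_card/fintype.subsetP => _ /imsetP[u uX ->].
  move: uX; rewrite inE => /eqP ux; rewrite inE; apply/eqP/rowP => i.
  by rewrite ord1 mulmxBl mxE [X in _ + X]mxE ux u0x subrr mxE.
have E : (#|[set u : 'rV[F]_m | u *m c != 0%R]%SET| = #|F| ^ m - #|K|)%N.
  by rewrite -card_rV -(cardsC K) addKn; apply: eq_card => u; rewrite !inE.
by rewrite E mulnBr -subn1 mulnBl mul1n leq_sub2l.
Qed.

(* Plotkin's averaging argument, on the codewords whose first block is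
   supported on the first m coordinates. *)
Lemma negacirculant_plotkin (F : finFieldType) s n m (C : {vspace 'rV[F]_(s.+1 * n)}) :
    (m <= n)%N -> negacirculant_code C ->
  (#|F| * ((#|F| ^ m).-1 * min_dist C) <= (m + s * n) * (#|F|.-1 * #|F| ^ m))%N.
Proof.
move=> mn [G [G0 _ ->]]; set d := min_dist _.
(* The first m rows of G generate this subcode. *)
pose G' := (pid_mx m : 'M[F]_(m, n)) *m G.
have G'0 i (k : 'I_n) : G' i (mxvec_index ord0 k) = (i == k :> nat)%:R.
  transitivity ((pid_mx m *m block G ord0) i k).
    by rewrite !mxE; apply: eq_bigr => j _; rewrite !mxE.
  by rewrite G0 // mulmx1 mxE ltn_ord andbT.
have wd (u : 'rV[F]_m) : u != 0 -> (d <= weight (u *m G'))%N.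
  move=> u0; apply: min_dist_leq.
    by apply/generated_byP; exists (u *m pid_mx m); rewrite mulmxA.
  apply: contraNneq u0 => uG; apply/eqP/rowP => i; rewrite mxE.
  have /rowP/(_ (mxvec_index ord0 (widen_ord mn i))) := uG.
  rewrite !mxE (bigD1 i) //= G'0 eqxx mulr1 big1 ?addr0 // => j ji.
  by rewrite G'0 val_eqE (negPf ji) mulr0.
have : ((#|F| ^ m).-1 * d <= \sum_(u : 'rV[F]_m) weight (u *m G'))%N.
  rewrite -card_rV (bigD1 0) //= (leq_trans _ (leq_addl _ _)) //.
  apply: (@leq_trans (\sum_(u : 'rV[F]_m | u != 0%R) d)%N); last exact: leq_sum.
  by rewrite sum_nat_const -(cardC1 (0 : 'rV[F]_m)).
pose cnt i := #|[set u : 'rV[F]_m | u *m col i G' != 0]%SET|.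
(* Double counting: sum the nonzero entries coordinate by coordinate instead of word by word. *)
have -> : (\sum_(u : 'rV[F]_m) weight (u *m G') = \sum_i cnt i)%N.
  transitivity (\sum_(u : 'rV[F]_m) \sum_i (if (u *m G') 0%R i != 0%R then 1 else 0))%N.
    by apply: eq_bigr => u _; rewrite -big_mkcond sum1dep_card.
  rewrite exchange_big /=; apply: eq_bigr => i _.
  rewrite /cnt -sum1_card [RHS]big_mkcond; apply: eq_bigr => u _; rewrite !inE.
  have uiE : (u *m col i G') 0 0 = (u *m G') 0 i.
    by rewrite !mxE; apply: eq_bigr => j _; rewrite mxE.
  suff -> : (u *m col i G' == 0) = ((u *m G') 0 i == 0) by [].
  apply/eqP/eqP => [ui|ui]; first by rewrite -uiE ui mxE.
  by apply/colP => k; rewrite ord1 uiE ui mxE.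
move/leq_mul => /(_ _ _ (leqnn #|F|)); rewrite mulnC [leqRHS]mulnC => /leq_trans; apply.
rewrite big_distrr /= (reindex _ (curry_mxvec_bij _ _)) /=.
rewrite (_ : \sum_(_ | _) _ =
  \sum_(b < s.+1) \sum_(k < n) #|F| * cnt (mxvec_index b k))%N; last first.
  by rewrite pair_bigA; apply: eq_bigr => -[].
(* Only m coordinates of the first block can be nonzero; each of the s other blocks contributes
   n. *)
rewrite big_ord_recl mulnDl.
apply: leq_add; last first.
  apply: (@leq_trans (\sum_(b < s) \sum_(k < n) (#|F|.-1 * #|F| ^ m))%N).
    by do 2![apply: leq_sum => ? _]; apply: card_mulmx_neq0.
  by rewrite !sum_nat_const !card_ord mulnA.
apply: (@leq_trans (\sum_(k < n | (k < m)%N) (#|F|.-1 * #|F| ^ m))%N).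
  rewrite big_mkcond [leqRHS]big_mkcond; apply: leq_sum => k _.
  case: ltnP => [_|mk]; first exact: card_mulmx_neq0.
  rewrite /cnt (_ : [set _ | _] = finset.set0) ?cards0 ?muln0 //.
  apply/setP => u; rewrite !inE; apply/negbF/eqP/colP => i; rewrite !mxE big1 // => j _.
  by rewrite mxE G'0 ltn_eqF ?mulr0 // (leq_trans (ltn_ord j)).
by rewrite (big_ord_narrow mn) sum_nat_const card_ord.
Qed.

(** * Asymptotics *)

Section LimnInf.
Variables (R : realType) (u : nat -> R).
Hypothesis u01 : forall j, 0 <= u j <= 1.

Lemma is_cvg_infs01 : cvgn (infs u).
Proof.
apply/cvg_ex; eexists; apply: cvg_infs_sup.
  by exists 1 => _ [j _ <-]; case/andP: (u01 j).
by exists 0 => _ [j _ <-]; case/andP: (u01 j).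
Qed.

Lemma limn_inf_ge y k : (forall j, (k <= j)%N -> y <= u j) -> y <= limn_inf u.
Proof.
move=> yu; apply: (limr_ge is_cvg_infs01); near=> n.
apply: lb_le_inf; first by exists (u n), n => /=.
move=> _ [j /= nj <-]; apply: yu; apply: leq_trans nj.
by near: n; apply: nbhs_infty_ge.
Unshelve. all: by end_near. Qed.

Lemma limn_inf_le y k : (forall j, (k <= j)%N -> u j <= y) -> limn_inf u <= y.
Proof.
move=> uy; apply: (limr_le is_cvg_infs01); near=> n.
apply: (@le_trans _ _ (u n)).
  apply: ge_inf; last by exists n => /=.
  by exists 0 => _ [j _ <-]; case/andP: (u01 j).
by apply: uy; near: n; apply: nbhs_infty_ge.
Unshelve. all: by end_near. Qed.

End LimnInf.

(** For n = 2^k, oddness of q makes n invertible in F, and k >= 4 gives 8 <= q^(n/2). *)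
Lemma LCD_code_exists (F : finFieldType) t k d :
    odd #|F| -> two_reciprocal_factors ('X^(2 ^ k) + 1 : {poly F}) ->
    (4 <= k)%N -> (2 <= t)%N -> (d <= t * 2 ^ k)%N ->
    (2 * #|ball F (t * 2 ^ k) d| < #|F| ^ (t.-1 * 2 ^ k.-1))%N ->
  exists C : {vspace 'rV[F]_(t * 2 ^ k)},
    [/\ negacirculant_code C, LCD C & (d <= min_dist C)%N].
Proof.
move=> oF [f [g fgP]]; case: k fgP => // k fgP k4; case: t => [|[|s]] // _ dN.
have q2 : (1 < #|F|)%N by apply: card_finNzRing_gt1.
have q8 : (8 <= #|F| ^ (2 ^ k))%N.
  apply: (@leq_trans (2 ^ (2 ^ k))); last by rewrite leq_exp2r ?expn_gt0.
  rewrite -[8%N]/(2 ^ 3)%N leq_exp2l // (leq_trans _ (ltnW (ltn_expl k _))) //.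
have n0 : (2 ^ k.+1)%:R != 0 :> F by rewrite natrX expf_neq0 // odd_card_two_neq0.
have n2m : (2 ^ k.+1 = (2 ^ k).*2)%N by rewrite expnS mul2n.
move: fgP dN n0 n2m; rewrite [k.+1.-1]/=; case: (2 ^ k.+1)%N (expn_gt0 2 k.+1) => // n' _.
by move=> fgP dN n0 n2m; apply: exists_LCD_nega_code n2m n0 fgP q8 dN.
Qed.

(** Maximality frees the family from any choice of y: one sequence satisfies the lower bounds for
    all admissible y. *)
Definition optimal_LCD_code (F : finFieldType) t n (C : {vspace 'rV[F]_(t * n)}) : Prop :=
  [/\ negacirculant_code C, LCD C
    & forall C' : {vspace 'rV[F]_(t * n)}, negacirculant_code C' -> LCD C' ->
        (min_dist C' <= min_dist C)%N].

Lemma optimal_LCD_code_exists (F : finFieldType) t n (C0 : {vspace 'rV[F]_(t * n)}) :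
  negacirculant_code C0 -> LCD C0 ->
  exists C : {vspace 'rV[F]_(t * n)}, optimal_LCD_code C.
Proof.
move=> C0n C0L.
pose P d := `[< exists C : {vspace 'rV[F]_(t * n)},
  [/\ negacirculant_code C, LCD C & min_dist C = d] >].
have exP : exists d, P d by exists (min_dist C0); apply/asboolP; exists C0.
have Ple d : P d -> (d <= t * n)%N.
  by move/asboolP => [C [_ _ <-]]; apply: min_dist_le_length.
case: (ex_maxnP exP Ple) => d /asboolP[C [Cn CL Cd]] dmax.
exists C; split=> // C' Cn' CL'; rewrite Cd; apply: dmax.
by apply/asboolP; exists C'.
Qed.

(** Here T = t, M = n/2, X = q^M and Y = q. Shortening gives the factor (2T - 1)/(2T), and X/(X - 1)
    is at most 4T/(4T - 1). *)
Lemma plotkin_ratio (R : realFieldType) (d T M X Y : R) :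
    2 <= T -> 0 < M -> 4 * T <= X -> 2 <= Y ->
    Y * ((X - 1) * d) <= (M + (T - 1) * (2 * M)) * ((Y - 1) * X) ->
  d / (T * (2 * M)) <= (4 * T - 2) / (4 * T - 1) * ((Y - 1) / Y).
Proof.
move=> T2 M0 TX Y2 H.
have X1 : 0 < X - 1 by lra.
have T1 : 0 < 4 * T - 1 by lra.
have Y0 : 0 < Y by lra.
pose A := (2 * T - 1) * M * ((Y - 1) / Y).
have A0 : 0 <= A by rewrite !mulr_ge0 ?invr_ge0; lra.
have dA : d <= A * (X / (X - 1)).
  rewrite (_ : _ * _ = (M + (T - 1) * (2 * M)) * ((Y - 1) * X) / (Y * (X - 1))).
    by rewrite ler_pdivlMr ?mulr_gt0 //; lra.
  by rewrite /A; field; lra.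
rewrite ler_pdivrMr; last by rewrite !mulr_gt0; lra.
apply: (le_trans dA).
rewrite [leRHS](_ : _ = A * (4 * T / (4 * T - 1))); last by rewrite /A; field; lra.
rewrite ler_wpM2l // ler_pdivrMr // mulrAC ler_pdivlMr //; lra.
Qed.

Section Asymptotics.
Variables (R : realType) (F : finFieldType) (t : nat).
Hypothesis oF : odd #|F|.
Hypothesis t2 : (2 <= t)%N.
Let q := #|F|.
(** The count q^((t-1) n/2) is q^(h N) for the length N = t n. *)
Let h : R := (t%:R - 1) / (2 * t%:R).

Lemma card_field_gt1 : (1 < q)%N.
Proof. exact: card_finNzRing_gt1. Qed.

(* Minimized over z, the left-hand side of the last hypothesis is H_q(y) ln q,
   so it is the Gilbert-Varshamov condition H_q(y) < h. *)
Lemma optimal_code_ge (y z : R) :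
    0 < y <= 1 -> 0 < z <= 1 ->
    ln (1 + (q.-1)%:R * z) - y * ln z < h * ln q%:R ->
  exists k0, forall k (C : {vspace 'rV[F]_(t * 2 ^ k)}), (k0 <= k)%N ->
    two_reciprocal_factors ('X^(2 ^ k) + 1 : {poly F}) -> optimal_LCD_code C ->
    y <= (min_dist C)%:R / (t * 2 ^ k)%:R.
Proof.
case/andP => y0 y1 z01 Lh; set L := ln _ - _ in Lh.
pose eta := h * ln q%:R - L; have eta0 : 0 < eta by rewrite subr_gt0.
(* The bound 4 serves [LCD_code_exists]; the other one makes N * eta > 1. *)
exists (maxn 4 (Num.bound eta^-1)) => k C; rewrite geq_max => /andP[k4 kb] fP [_ _ Copt].
set N := (t * 2 ^ k)%N.
have N0 : 0 < N%:R :> R by rewrite ltr0n muln_gt0 expn_gt0 andbT ltnW.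
rewrite ler_pdivlMr //.
have exd : exists d, y * N%:R <= d%:R :> R by exists N; rewrite ger_pMl.
(* d is y N rounded up, so every smaller natural number is at most y N. *)
case: (ex_minnP exd) => d yd dmin.
have dN : (d <= N)%N by apply: dmin; rewrite ger_pMl.
suff Vd : (2 * #|ball F N d| < #|F| ^ (t.-1 * 2 ^ k.-1))%N.
  have [C' [C'n C'L dC']] := LCD_code_exists oF fP k4 t2 dN Vd.
  by apply: le_trans yd _; rewrite ler_nat (leq_trans dC') // Copt.
have T2 : 2 <= t%:R :> R by rewrite ler_nat.
rewrite -(ltr_nat R) natrM -/q.
  have dy j : (j < d)%N -> j%:R <= y * N%:R :> R.
    by rewrite ltnNge => jd; apply: ltW; rewrite ltNge; apply: contra jd; apply: dmin.
  have := card_ball_le F z01 dy; rewrite -/q -/L => Vle.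
  apply: (@le_lt_trans _ _ (2 * expR (N%:R * L))); first by rewrite ler_pM2l.
  have Ne : 1 < N%:R * eta.
    rewrite -ltr_pdivrMr // mul1r (lt_le_trans (archi_boundP _)) ?invr_ge0 ?ltW //.
    rewrite ltr_nat (leq_ltn_trans kb) // (leq_trans (ltn_expl k (isT : 1 < 2)%N)) //.
    by rewrite leq_pmull // ltnW.
  have -> : (q ^ (t.-1 * 2 ^ k.-1))%:R = expR (N%:R * L) * expR (N%:R * eta) :> R.
    rewrite -expRD -mulrDr /eta addrC subrK natrX -[q%:R in LHS]lnK; last first.
      by rewrite posrE ltr0n ltnW ?card_field_gt1.
    rewrite -expRM_natl; congr expR; rewrite mulrA; congr (_ * _).
    have kE : (2 ^ k = 2 * 2 ^ k.-1)%N by rewrite -expnS prednK // (leq_trans _ k4).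
    rewrite /N kE !natrM.
    rewrite -subn1 natrB 1?ltnW // /h; field; lra.
  (* The factor 2 is beaten by exp(N eta) >= 1 + N eta > 2. *)
  rewrite mulrC ltr_pM2l ?expR_gt0 //.
  have := expR_ge1Dx (N%:R * eta); lra.
Qed.

(** Plotkin's bound with the first block cut to half: the length lost is a fixed fraction of t n,
    which leaves a constant below (q - 1)/q. *)
Lemma negacirculant_code_le : exists k0, forall k (C : {vspace 'rV[F]_(t * 2 ^ k)}),
  (k0 <= k)%N -> negacirculant_code C ->
  (min_dist C)%:R / (t * 2 ^ k)%:R <=
    (4 * t%:R - 2) / (4 * t%:R - 1) * ((q%:R - 1) / q%:R) :> R.
Proof.
(* The threshold ensures 4 t <= q^m for m = n/2. *)
exists (4 * t).+1 => -[//|k] C; rewrite ltnS => tk Cn.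
pose m := (2 ^ k)%N; pose Q := (q ^ m)%N.
have tQ : (4 * t <= Q)%N.
  apply: leq_trans tk (leq_trans (ltnW (ltn_expl k (isT : 1 < 2)%N)) _).
  exact: ltnW (ltn_expl _ card_field_gt1).
have n2m : (2 ^ k.+1 = 2 * m)%N by rewrite expnS.
case: t t2 C Cn tQ => // s s2 C Cn tQ.
have q2 := card_field_gt1.
have S2 : 2 <= s.+1%:R :> R by rewrite ler_nat.
have Q2 : 2 <= q%:R :> R by rewrite ler_nat.
have mn : (m <= 2 ^ k.+1)%N by rewrite n2m leq_pmull.
have := negacirculant_plotkin mn Cn; rewrite -/q -/Q -(ler_nat R).
have Q0 : (0 < Q)%N by rewrite (leq_trans _ tQ) // muln_gt0.
have qE : (q.-1)%:R = q%:R - 1 :> R by rewrite -subn1 natrB 1?ltnW.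
have QE : (Q.-1)%:R = Q%:R - 1 :> R by rewrite -subn1 natrB.
have sE : s%:R = s.+1%:R - 1 :> R by rewrite -natr1 addrK.
have m0 : 0 < m%:R :> R by rewrite ltr0n expn_gt0.
have tQ' : 4 * s.+1%:R <= Q%:R :> R by rewrite -natrM ler_nat.
move: (min_dist C) => d; rewrite !natrM n2m natrD !natrM qE QE sE.
exact: plotkin_ratio.
Qed.

End Asymptotics.

(** * From Chernoff's exponent to the entropy *)

Lemma exists_pos_slack (R : realFieldType) (M c b A : R) :
  0 < M -> c < b -> 0 <= A -> exists2 e, 0 < e <= M & c + e * A < b.
Proof.
move=> M0 cb A0; have A1 : 0 < A + 1 by lra.
(* The denominator A + 1 also covers A = 0. *)
exists (Num.min M ((b - c) / (A + 1))).
  by rewrite lt_min M0 divr_gt0 ?subr_gt0 //= ge_min lexx.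
rewrite -ltrBrDl; apply: (@le_lt_trans _ _ ((b - c) / (A + 1) * A)).
  by rewrite ler_wpM2r // ge_min lexx orbT.
rewrite mulrAC ltr_pdivrMr // ltr_pM2l ?subr_gt0 //; lra.
Qed.

(* The minimum over z of the Chernoff exponent is attained at this z. *)
Lemma entropy_chernoff (R : realType) (q : nat) (y : R) :
    (1 < q)%N -> 0 < y < 1 ->
  let z := y / ((q%:R - 1) * (1 - y)) in
  entropy q y * ln q%:R = ln (1 + (q%:R - 1) * z) - y * ln z.
Proof.
move=> q1 /andP[y0 y1] z.
have q1' : 1 < q%:R :> R by rewrite ltr1n.
have Q0 : 0 < q%:R - 1 :> R by rewrite subr_gt0.
have Y0 : 0 < 1 - y by rewrite subr_gt0.
have lq : ln q%:R != 0 :> R by rewrite gt_eqF ?ln_gt0.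
have -> : 1 + (q%:R - 1) * z = (1 - y)^-1.
  by rewrite /z; field; rewrite !gt_eqF.
rewrite lnV ?posrE // /z ln_div ?posrE ?mulr_gt0 // lnM ?posrE //.
rewrite /entropy /logb; field; exact: lq.
Qed.

(** If the entropy at delta were below h, the Chernoff condition would hold at delta with the
    optimal z, hence also slightly above delta, which is absurd. *)
Lemma entropy_ge_of_chernoff (R : realType) (q : nat) (h delta : R) :
    (1 < q)%N -> 0 < h -> delta < (q%:R - 1) / q%:R ->
    (forall y z, 0 < y <= 1 -> 0 < z <= 1 ->
       ln (1 + (q%:R - 1) * z) - y * ln z < h * ln q%:R -> y <= delta) ->
  0 < delta < (q%:R - 1) / q%:R /\ h <= entropy q delta.
Proof.
move=> q1 h0 delta_lt delta_ge.
have q1' : 1 < q%:R :> R by rewrite ltr1n.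
have lq : 0 < ln q%:R :> R by rewrite ln_gt0.
(* A small z makes the logarithm small; then a small y absorbs - y ln z. *)
have [z /andP[z0 z1] lnz] : exists2 z, 0 < z <= 1 & 0 + z * (q%:R - 1) < h * ln q%:R.
  by apply: exists_pos_slack; rewrite ?mulr_gt0 //; lra.
have delta_gt0 : 0 < delta.
  have lnz' : ln (1 + (q%:R - 1) * z) < h * ln q%:R.
    apply: le_lt_trans lnz; rewrite add0r mulrC; apply: le_ln1Dx.
    by rewrite (lt_trans (ltrN10 R)) // mulr_gt0 // subr_gt0.
  have [|y /andP[y0 y1] yP] := exists_pos_slack (@ltr01 R) lnz' (_ : 0 <= - ln z).
    by rewrite oppr_ge0 ln_le0.
  by apply: (lt_le_trans y0 (delta_ge _ z _ _ _)); rewrite ?y0 ?z0 // -mulrN.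
rewrite delta_gt0 delta_lt; split=> //; rewrite leNgt; apply/negP => entropy_lt.
have delta_lt1 : delta < 1.
  by apply: lt_trans delta_lt _; rewrite ltr_pdivrMr; lra.
pose w := delta / ((q%:R - 1) * (1 - delta)).
have w0 : 0 < w by rewrite divr_gt0 // mulr_gt0 ?subr_gt0.
(* Equivalent to delta <= (q - 1)/q. *)
have w1 : w <= 1.
  rewrite ler_pdivrMr ?mulr_gt0 ?subr_gt0 // mul1r.
  by move: delta_lt; rewrite ltr_pdivlMr; lra.
have := entropy_lt; rewrite -(ltr_pM2r lq) entropy_chernoff ?delta_gt0 // -/w => wP.
have [||eps /andP[eps0 eps1] epsP] :=
  exists_pos_slack (_ : 0 < 1 - delta) wP (_ : 0 <= - ln w).
- by rewrite subr_gt0.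
- by rewrite oppr_ge0 ln_le0.
have : delta + eps <= delta.
  apply: (delta_ge _ w); rewrite ?w0 //; first by rewrite addr_gt0 //= -lerBrDl.
  by apply: le_lt_trans epsP; rewrite (mulrDl delta) opprD addrA mulrN.
by rewrite gerDl leNgt eps0.
Qed.

Lemma plotkin_factor_lt1 (R : realFieldType) (q : nat) (T : R) :
    2 <= T -> (1 < q)%N ->
  (4 * T - 2) / (4 * T - 1) * ((q%:R - 1) / q%:R) < (q%:R - 1) / q%:R.
Proof.
rewrite -(ltr1n R) => T2 q1; rewrite gtr_pMl ?divr_gt0 ?ltr_pdivrMr; lra.
Qed.

Theorem theorem8p2 (R : realType) (F : finFieldType) (q : nat)
    (card_F : #|F| = q) (odd_q : odd q)
    (factorization : exists K : nat, forall k : nat, (K <= k)%N ->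
       two_reciprocal_factors ('X^(2 ^ k) + 1 : {poly F}))
    (t : nat) (ht : (2 <= t)%N) :
  exists (e : nat -> nat)
         (C : forall j : nat, {vspace 'rV[F]_(t * 2 ^ e j)}),
    [/\ {homo e : i j / (i < j)%N},
        forall j : nat, negacirculant_code (C j),
        forall j : nat, LCD (C j)
      & let delta : R := relative_distance R C in
        0 < delta < (q%:R - 1) / q%:R
        /\ (t%:R - 1) / (2 * t%:R) <= entropy q delta].
Proof.
(* The shift puts every [e j] in the range of both the factorization and [LCD_code_exists]. *)
have [K fP] := factorization; pose e j := (K + 4 + j)%N.
have eK j : (K <= e j)%N by rewrite /e -addnA leq_addr.
have e4 j : (4 <= e j)%N by rewrite /e addnAC leq_addl.
have ej j : (j <= e j)%N by rewrite leq_addl.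
have odd_F : odd #|F| by rewrite card_F.
have exC j : exists C : {vspace 'rV[F]_(t * 2 ^ e j)}, optimal_LCD_code C.
  (* With d = 0 the ball is empty and the counting condition is trivial. *)
  have [|C0 [C0n C0L _]] := LCD_code_exists odd_F (fP _ (eK j)) (e4 j) ht (leq0n _).
    rewrite (_ : ball _ _ _ = finset.set0) ?cards0 ?muln0 ?expn_gt0.
      by rewrite (ltnW (card_finNzRing_gt1 F)).
    by apply/setP => w; rewrite !inE.
  exact: optimal_LCD_code_exists C0n C0L.
pose C j := sval (cid (exC j)).
have Copt j : optimal_LCD_code (C j) by exact: svalP (cid (exC j)).
exists e, C; split=> [i j ij|j|j|]; first by rewrite ltn_add2l.
- by have [] := Copt j.
- by have [] := Copt j.
move=> delta.
have q1 : (1 < q)%N by rewrite -card_F card_finNzRing_gt1.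
have T2 : 2 <= t%:R :> R by rewrite ler_nat.
have qE : (#|F|.-1)%:R = q%:R - 1 :> R by rewrite card_F -subn1 natrB 1?ltnW.
have N0 j : 0 < (t * 2 ^ e j)%:R :> R.
  by rewrite ltr0n muln_gt0 expn_gt0 andbT ltnW.
have u01 j : 0 <= ((min_dist (C j))%:R / (t * 2 ^ e j)%:R : R) <= 1.
  rewrite divr_ge0 ?ler0n //= ler_pdivrMr // mul1r ler_nat.
  exact: min_dist_le_length.
(* Plotkin's bound controls delta from above, maximality of the codes from below. *)
apply: entropy_ge_of_chernoff => // [||y z y01 z01].
- by rewrite divr_gt0 ?mulr_gt0 ?subr_gt0 ?ltr1n ?ltr0n // ltnW.
- have [k0 k0P] := negacirculant_code_le R F ht.
  apply: le_lt_trans (plotkin_factor_lt1 T2 q1).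
  rewrite -card_F; apply: (limn_inf_le u01 (k := k0)) => j jk.
  by apply: k0P; [apply: leq_trans jk (ej j)|have [] := Copt j].
- rewrite -qE -card_F => yz; have [k0 k0P] := optimal_code_ge odd_F ht y01 z01 yz.
  apply: (limn_inf_ge u01 (k := k0)) => j jk.
  by apply: k0P => //; [apply: leq_trans jk (ej j)|apply: fP].
Qed.
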